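(* Let $p$ be an odd prime, $e$ a positive integer, $q=p^e$ and $Q=q^2$. Let $T\in\mathbb{F}_Q[X,Y,Z]$ be the polynomial $$T(X,Y,Z) = XY-2^{-1}t_{(Q+1)/2}(X)\,t_q(Y) + Z - \sum_{i=0}^{q-2}g_i(X)\,t_q(Y)^{i+1}\,t_q(Z)^{q-(i+1)},$$ where $$g_i(X) = (-4)^{-(i+1)}\sum_{j=0}^{i+1} C[j(q-1)+i]\,X^{j(q-1)+i+1}.$$ Then: - for each $(y,z)\in\mathbb{F}_Q^\star\times\mathbb{F}_Q$, $T(X,y,z)$ is a permutation polynomial over $\mathbb{F}_Q$; - for each $(x,z)\in\mathbb{F}_Q^\star\times\mathbb{F}_Q$, $T(x,Y,z)$ is a permutation polynomial over $\mathbb{F}_Q$; - for each $(x,y)\in\mathbb{F}_Q\times\mathbb{F}_Q$, $T(x,y,Z)$ is a permutation polynomial over $\mathbb{F}_Q$.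
   Context: $\mathbb{F}_Q$ is the finite field with $Q$ elements, $\mathbb{F}_Q^\star=\mathbb{F}_Q\setminus\{0\}$. $t_n(X)=X^n-X$. $C[n]=\frac{1}{n+1}\binom{2n}{n}$ is the $n$-th Catalan number; integers (and inverses of integers prime to $p$) are read in $\mathbb{F}_p\subset\mathbb{F}_Q$ when used as coefficients. A permutation polynomial over $\mathbb{F}_Q$ is a univariate polynomial over $\mathbb{F}_Q$ whose evaluation map $\mathbb{F}_Q\to\mathbb{F}_Q$ is a bijection. *)

(* Defs.v *)
From HB Require Import structures.
From mathcomp Require Import all_boot all_order all_algebra.
From mathcomp Require Import mpoly.

Set Implicit Arguments.
Unset Strict Implicit.
Unset Printing Implicit Defensive.

Import GRing.Theory.

Local Open Scope ring_scope.

(* The division is exact. *)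
Definition catalan (n : nat) : nat := ('C(n.*2, n) %/ n.+1)%N.

Definition t_poly (F : fieldType) (n : nat) : {poly F} := 'X^n - 'X.

Definition g_poly (F : fieldType) (q i : nat) : {poly F} :=
  (- 4%:R) ^- i.+1 *:
    \sum_(j < i.+2) (catalan (j * q.-1 + i)%N)%:R *: 'X^(j * q.-1 + i.+1)%N.

(* [horner_alg a f] substitutes [a] for the variable of [f]. *)
Definition T_mpoly (F : fieldType) (q : nat) : {mpoly F[3]} :=
  let X : {mpoly F[3]} := 'X_0 in
  let Y : {mpoly F[3]} := 'X_1 in
  let Z : {mpoly F[3]} := 'X_2 in
  X * Y
  - 2%:R^-1 *: (horner_alg X (t_poly F ((q ^ 2 + 1)%N./2))
                * horner_alg Y (t_poly F q))
  + Z
  - \sum_(i < q.-1)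
      horner_alg X (g_poly F q i) * horner_alg Y (t_poly F q) ^+ i.+1
      * horner_alg Z (t_poly F q) ^+ (q - i.+1).

(* The univariate polynomial obtained from [P] by substituting [a], [b], [c]
   for its three variables; at ['X], [y%:P], [z%:P] this is P(X, y, z). *)
Definition subst3 (F : fieldType) (P : {mpoly F[3]}) (a b c : {poly F})
  : {poly F} := mmap polyC (tnth [tuple a; b; c]) P.

Definition permutation_poly (F : finFieldType) (f : {poly F}) : Prop :=
  bijective (fun x : F => f.[x]).

(* Main.v *)
Require Import Defs.
From mathcomp Require Import all_boot all_order all_algebra all_field.
From mathcomp Require Import mpoly ring zify.

Import GRing.Theory.
Local Open Scope ring_scope.

(** Write A = xy + z and B = x y^q + z^q. On F_Q the polynomial T takes the
    value B or A according to the quadratic character of B - A. Indeed, by the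
    generating function of the Catalan numbers, 2 C[n] is minus the coefficient
    of s^(n+1) in (1 - 4s)^((Q+1)/2) modulo p for n + 1 < Q, so by Lucas'
    theorem g_i(X) is up to the factor -1/2 the coefficient of U^(i+1) in
    (1 + X^q U)^((q-1)/2) (1 + X U)^((q+1)/2); homogenizing at u = t_q(y),
    v = t_q(z) and putting m = v + xu = B - A, the sum in T becomes a multiple
    of (-m^q)^((q-1)/2) m^((q+1)/2) plus correction terms which cancel.
    When one variable varies, giving pairs (A, B) and (A', B'), the differences
    A' - A and B' - B have the same quadratic character, since one is obtained
    from the other by applying the Frobenius to a factor. If T took the value
    B = A' at both arguments, then B - A = A' - A and B' - A' = B' - B would
    have the same character, although they lie in different branches. *)

(** * Catalan numbers and central binomial coefficients *)

Lemma mul_Sn_catalan n : (n.+1 * catalan n)%N = 'C(n.*2, n).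
Proof.
rewrite mulnC divnK //.
(* The exact quotient is ['C(n.*2, n) - 'C(n.*2, n.+1)]. *)
have E : (n.+1 * ('C(n.*2, n) - 'C(n.*2, n.+1)))%N = 'C(n.*2, n).
  by rewrite mulnBr mul_bin_left -addnn addnK mulSn addnK.
by rewrite -[X in (_ %| X)%N]E dvdn_mulr.
Qed.

Lemma central_binS n :
  (n.+1 * 'C(n.+1.*2, n.+1))%N = ((4 * n + 2) * 'C(n.*2, n))%N.
Proof.
have E1 := mul_bin_diag n.*2.+2 n.
have E2 := mul_bin_down n.*2.+1 n.
rewrite doubleS; rewrite /= in E1 E2.
have E3 : (n.*2.+1 - n = n.+1)%N by lia.
rewrite E3 in E2; nia.
Qed.

(** Hence (1 - 4s) G(s), with G the generating series of the central binomial coefficients, has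
    coefficient -2 C[n] at s^(n+1). *)
Lemma catalan_central_bin n :
  (2 * catalan n + 'C(n.+1.*2, n.+1))%N = (4 * 'C(n.*2, n))%N.
Proof. by have := mul_Sn_catalan n; have := central_binS n; nia. Qed.

(** This is G^2 = 1 / (1 - 4s). The symmetry i -> n - i gives 2 w(n) = n s(n), the recurrence of the
    central binomials gives w(n+1) = 4 w(n) + 2 s(n); together, s(n+1) = 4 s(n). *)
Lemma sum_central_bin n :
  (\sum_(i < n.+1) 'C(i.*2, i) * 'C((n - i).*2, n - i))%N = (4 ^ n)%N.
Proof.
pose c i := 'C(i.*2, i).
pose s n := (\sum_(i < n.+1) c i * c (n - i))%N.
pose w n := (\sum_(i < n.+1) i * (c i * c (n - i)))%N.
have w2 m : (2 * w m = m * s m)%N.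
  rewrite mul2n -addnn {1}/w (reindex_inj rev_ord_inj) /= /w /s big_distrr /=.
  rewrite -big_split /=; apply: eq_bigr => i _.
  rewrite !subSS subKn -1?ltnS // [(c (m - i) * _)%N]mulnC -mulnDl.
  by rewrite subnK // -ltnS.
have wS m : (w m.+1 = 4 * w m + 2 * s m)%N.
  rewrite /w big_ord_recl mul0n add0n /s !big_distrr -big_split /=.
  apply: eq_bigr => i _; rewrite /bump /= add1n subSS mulnA central_binS.
  by rewrite -/(c _) -/(c _); nia.
rewrite -/(s n); elim: n => [|n IHn]; first by rewrite /s big_ord1 /c !bin0.
have := w2 n.+1; rewrite wS expnS -IHn => E.
have := w2 n => E2; nia.
Qed.

(** * Products of powers of linear polynomials *)

Lemma coef_exprDCZX (R : comNzRingType) (v c : R) n k :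
  ((v%:P + c *: 'X) ^+ n)`_k = v ^+ (n - k) * c ^+ k *+ 'C(n, k).
Proof.
have -> : (v%:P + c *: 'X) ^+ n
    = \poly_(i < n.+1) (v ^+ (n - i) * c ^+ i *+ 'C(n, i)).
  rewrite exprDn poly_def; apply: eq_bigr => i _.
  by rewrite exprZn -rmorphXn /= mul_polyC scalerA scalerMnl.
by rewrite coef_poly; case: ltnP => // /bin_small ->; rewrite mulr0n.
Qed.

Lemma coef_expr1DZX (R : comNzRingType) (c : R) n k :
  ((1 + c *: 'X) ^+ n)`_k = c ^+ k *+ 'C(n, k).
Proof. by rewrite -[1]/(1%:P) coef_exprDCZX expr1n mul1r. Qed.

(** The inner sum is the coefficient of U^d in (1 + a U)^h (1 + b U)^k, here homogenized in u and
    v. *)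
Lemma sum_binM_hom (R : comNzRingType) (a b u v : R) h k :
  \sum_(d < (h + k).+1)
     (\sum_(j < d.+1) ('C(h, j) * 'C(k, d - j))%:R * a ^+ j * b ^+ (d - j))
       * u ^+ d * v ^+ (h + k - d)
  = (v + a * u) ^+ h * (v + b * u) ^+ k.
Proof.
pose W := (v%:P + (a * u) *: 'X) ^+ h * (v%:P + (b * u) *: 'X) ^+ k.
have szE (c : R) n : (size ((v%:P + c *: 'X) ^+ n) <= n.+1)%N.
  by apply/leq_sizeP=> j lj; rewrite coef_exprDCZX bin_small.
have szW : (size W <= (h + k).+1)%N.
  apply: leq_trans (size_polyMleq _ _) _.
  by have := szE (a * u) h; have := szE (b * u) k; lia.
have -> : (v + a * u) ^+ h * (v + b * u) ^+ k = W.[1].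
  by rewrite hornerM !horner_exp !hornerE.
rewrite (horner_coef_wide _ szW); apply: eq_bigr => d _.
rewrite expr1n mulr1 coefM -mulrA big_distrl /=; apply: eq_bigr => j _.
rewrite !coef_exprDCZX natrM.
have [jh|jh] := leqP j h; last by rewrite (bin_small jh) !(mulr0n, mul0r).
have [jk|jk] := leqP (d - j) k; last first.
  by rewrite (bin_small jk) !(mulr0n, mulr0, mul0r).
have jd : (j <= d)%N by rewrite -ltnS.
have -> : (h + k - d = (h - j) + (k - (d - j)))%N by lia.
have -> : u ^+ d = u ^+ j * u ^+ (d - j) by rewrite -exprD subnKC.
rewrite exprD !exprMn -!(mulr_natr (_ * _)).
move: (v ^+ _) (v ^+ _) (a ^+ _) (b ^+ _) (u ^+ _) (u ^+ _) _%:R _%:R.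
by move=> *; ring.
Qed.

(** * Characteristic p: Frobenius, Lucas' theorem, Catalan numbers *)

Lemma natr_expn_pchar (R : comNzRingType) q n :
  [pchar R].-nat q -> n%:R ^+ q = n%:R :> R.
Proof.
move=> qR; elim: n => [|n IHn].
  by rewrite expr0n; case: q qR.
by rewrite -natr1 (exprDn_pchar _ _ qR) IHn expr1n.
Qed.

Lemma opprXn_pchar (R : comNzRingType) q (x : R) :
  [pchar R].-nat q -> (- x) ^+ q = - x ^+ q.
Proof.
move=> qR; apply/eqP; rewrite -addr_eq0 -(exprDn_pchar _ _ qR) addNr expr0n.
by case: q qR.
Qed.

Lemma subrXn_pchar (R : comNzRingType) q (x y : R) :
  [pchar R].-nat q -> (x - y) ^+ q = x ^+ q - y ^+ q.
Proof. by move=> qR; rewrite exprDn_pchar // opprXn_pchar. Qed.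

(** In (1 + X)^(aq + r) = (1 + X^q)^a (1 + X)^r only the term X^(jq) of the first factor contributes
    to X^(jq + b), because r and b are below q. *)
Lemma lucas_pchar (R : comNzRingType) q a r j b :
    [pchar R].-nat q -> (r < q)%N -> (b < q)%N ->
  'C(a * q + r, j * q + b)%:R = ('C(a, j) * 'C(r, b))%:R :> R.
Proof.
move=> qR rq bq.
have c1 n k : 'C(n, k)%:R = ((1 + 'X) ^+ n)`_k :> R.
  by rewrite -['X]scale1r coef_expr1DZX expr1n.
have q0 : (0 < q)%N by case: q qR {rq bq}.
have qP : [pchar {poly R}].-nat q.
  by move: qR; rewrite !/pnat q0; apply: sub_all => l; rewrite pchar_poly.
have -> : 'C(a * q + r, j * q + b)%:R
    = (((1 + 'X) ^+ a \Po 'X^q) * (1 + 'X) ^+ r)`_(j * q + b) :> R.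
  rewrite c1 exprD mulnC exprM (exprDn_pchar _ _ qP) expr1n.
  by rewrite rmorphXn rmorphD /= comp_polyC comp_polyX.
rewrite coefM.
have jb : (j * q < (j * q + b).+1)%N by rewrite ltnS leq_addr.
rewrite (bigD1 (Ordinal jb)) //= coef_comp_poly_Xn // dvdn_mull // mulnK //.
rewrite addKn -!c1 natrM big1 ?addr0 // => i /eqP nij.
rewrite coef_comp_poly_Xn //; case: dvdnP => [[k Ei]|]; last by rewrite mul0r.
rewrite -(c1 r) bin_small ?mulr0 //.
have lti := ltn_ord i; rewrite Ei in lti *.
have kj : (k < j)%N.
  rewrite ltnNge; apply/negP => jk; apply: nij.
  apply: val_inj => /=; rewrite Ei.
  have [//|] := eqVneq k j; nia.
have : (k.+1 * q <= j * q)%N by rewrite leq_mul2r kj orbT.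
rewrite mulSn; lia.
Qed.

(* With G the generating series of the central binomial coefficients, both
   (1 - 4X) G and (1 - 4X)^M are square roots of 1 - 4X modulo X^Q. *)
Lemma catalan_pchar (F : fieldType) Q M n :
    [pchar F].-nat Q -> (2%:R : F) != 0 -> M.*2 = Q.+1 -> (n.+1 < Q)%N ->
  2%:R * (catalan n)%:R = - ((- 4%:R) ^+ n.+1 *+ 'C(M, n.+1)) :> F.
Proof.
move=> QF two0 defM ltnQ.
pose L : {poly F} := 1 + (- 4%:R) *: 'X.
pose G : {poly F} := \poly_(i < Q) 'C(i.*2, i)%:R.
pose H := L * G; pose P := L ^+ M.
have Q0 : (0 < Q)%N by apply: leq_trans ltnQ.
have dvdXQ (f : {poly F}) : ('X^Q %| f) = [forall k : 'I_Q, f`_k == 0].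
  apply/idP/forallP => [/dvdpP[g ->] k|f0]; first by rewrite coefMXn ltn_ord.
  rewrite -(poly_take_drop Q f) dvdp_addl ?dvdp_mulIr //.
  suff -> : take_poly Q f = 0 by rewrite dvdp0.
  apply/polyP => k; rewrite coef_take_poly coef0.
  by case: ltnP => // lt; apply/eqP/(f0 (Ordinal lt)).
have coefL (f : {poly F}) k : (L * f)`_k.+1 = f`_k.+1 - 4%:R * f`_k.
  by rewrite mulrDl mul1r coefD -scalerAl coefZ coefXM /= mulNr.
have coefL0 (f : {poly F}) : (L * f)`_0 = f`_0.
  by rewrite mulrDl mul1r coefD -scalerAl coefZ coefXM /= mulr0 addr0.
have GG k : (k < Q)%N -> (G * G)`_k = 4%:R ^+ k.
  move=> ltk; rewrite coefM -natrX -sum_central_bin natr_sum.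
  apply: eq_bigr => i _; rewrite !coef_poly natrM.
  have -> : (i < Q)%N by apply: leq_trans (ltn_ord i) ltk.
  by have -> : (k - i < Q)%N by apply: leq_ltn_trans (leq_subr _ _) ltk.
have dvdH : 'X^Q %| H ^+ 2 - L.
  have -> : H ^+ 2 - L = L * (L * (G * G) - 1) by rewrite /H; ring.
  rewrite dvdp_mull // dvdXQ; apply/forallP => -[[|k] ltk] /=.
    by rewrite coefB coefL0 GG // coef1 subrr.
  by rewrite coefB coefL !GG // ?(ltnW ltk) // coef1 subr0 exprS subrr.
have dvdP : 'X^Q %| P ^+ 2 - L.
  have QP : [pchar {poly F}].-nat Q.
    by move: QF; rewrite !/pnat Q0; apply: sub_all => l; rewrite pchar_poly.
  (* P^2 = L^(Q+1), and L^Q = 1 modulo X^Q by Frobenius. *)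
  have -> : P ^+ 2 - L = L * (L ^+ Q - 1).
    by rewrite -exprM muln2 defM exprS mulrBr mulr1.
  rewrite dvdp_mull // (exprDn_pchar _ _ QP) expr1n addrC addKr exprZn.
  by rewrite -mul_polyC dvdp_mull.
have H0 : H`_0 = 1 by rewrite coefL0 coef_poly Q0.
have P0 : P`_0 = 1 by rewrite coef_expr1DZX expr0 bin0.
(* The constant term of H + P is 2, a unit, so the square roots H and P agree modulo X^Q. *)
have cop : coprimep 'X^Q (H + P).
  rewrite coprimep_expl // coprimep_sym coprimepX rootE horner_coef0.
  by rewrite coefD H0 P0; exact: two0.
have : 'X^Q %| (H - P) * (H + P).
  have -> : (H - P) * (H + P) = (H ^+ 2 - L) - (P ^+ 2 - L) by ring.
  by rewrite dvdp_sub.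
rewrite (Gauss_dvdpl _ cop) dvdXQ => /forallP/(_ (Ordinal ltnQ)) /=.
rewrite coefB subr_eq0 => /eqP; rewrite -coef_expr1DZX -/P => <-.
rewrite coefL !coef_poly ltnQ (ltnW ltnQ) -!natrM -catalan_central_bin.
by rewrite natrD; ring.
Qed.

(** * The sum of the g_i in closed form *)

Lemma g_poly_horner (F : fieldType) h q i (x : F) :
    [pchar F].-nat q -> (2%:R : F) != 0 -> q = h.*2.+1 -> (i < q.-1)%N ->
  (g_poly F q i).[x] = - 2%:R^-1 *
    \sum_(j < i.+2) ('C(h, j) * 'C(h.+1, i.+1 - j))%:R
      * (x ^+ q) ^+ j * x ^+ (i.+1 - j).
Proof.
move=> qF two0 defq lti; rewrite hornerZ horner_sum !big_distrr.
apply: eq_bigr => j _ /=; rewrite hornerZ hornerXn.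
have lj : (j <= i.+1)%N by rewrite -ltnS.
have four0 : (- 4%:R : F) != 0.
  by rewrite oppr_eq0 -[4%N]/(2 * 2)%N natrM mulf_neq0.
(* -4 is in the prime field; this removes j from the power of -4. *)
have four1 : (- 4%:R : F) ^+ q.-1 = 1.
  apply: (mulfI four0); rewrite -exprS prednK ?defq // -defq mulr1.
  by rewrite opprXn_pchar // natr_expn_pchar.
(* In base q, the index has digits j and i+1-j, and (Q+1)/2 has digits h and h+1. *)
have Ej : ((j * q.-1 + i).+1 = j * q + (i.+1 - j))%N by rewrite defq /=; lia.
have QF : [pchar F].-nat (q ^ 2)%N by rewrite pnatX qF.
have defM : ((h * q + h.+1).*2 = (q ^ 2).+1)%N by rewrite defq; nia.
have ltn : ((j * q.-1 + i).+1 < q ^ 2)%N by nia.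
have := catalan_pchar _ _ _ _ QF two0 defM ltn.
have -> : (- 4%:R : F) ^+ (j * q.-1 + i).+1 = (- 4%:R) ^+ i.+1.
  by rewrite -addnS exprD mulnC exprM four1 expr1n mul1r.
rewrite -(mulr_natr (_ ^+ _)) Ej lucas_pchar //; try lia; move=> E.
rewrite addnS Ej exprD (mulnC j q) exprM.
have -> : (catalan (j * q.-1 + i))%:R = - 2%:R^-1 * ((- 4%:R) ^+ i.+1
   * ('C(h, j) * 'C(h.+1, i.+1 - j))%:R) :> F.
  by apply: (mulfI two0); rewrite E [RHS]mulrA mulrN mulfV // mulN1r.
rewrite -!mulrA mulrCA [X in _ * X = _]mulrA mulVf ?mul1r // expf_neq0 //.
Qed.

(** The homogeneous expansion runs over 0 <= d <= q, the sum over i only over d = i+1 from 1 to q-1;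
    the two end terms are subtracted. *)
Lemma sum_g_poly (F : fieldType) h q (x u v : F) :
    [pchar F].-nat q -> (2%:R : F) != 0 -> q = h.*2.+1 ->
  \sum_(i < q.-1) (g_poly F q i).[x] * u ^+ i.+1 * v ^+ (q - i.+1)
  = - 2%:R^-1 * ((v + x ^+ q * u) ^+ h * (v + x * u) ^+ h.+1
                 - v ^+ q - (x ^+ q) ^+ h * x ^+ h.+1 * u ^+ q).
Proof.
move=> qF two0 defq; rewrite defq in qF *; set n := h.*2.+1 in qF *.
pose W d : F := \sum_(j < d.+1)
  ('C(h, j) * 'C(h.+1, d - j))%:R * (x ^+ n) ^+ j * x ^+ (d - j).
have W0 : W 0%N = 1 by rewrite /W big_ord1 !bin0 !expr0 !mulr1.
have Wn : W n = (x ^+ n) ^+ h * x ^+ h.+1.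
  have lth : (h < n.+1)%N by rewrite /n; lia.
  have Enh : (n - h = h.+1)%N by rewrite /n; lia.
  (* Only j = h survives: the first binomial vanishes for j > h, the second for j < h. *)
  rewrite /W (bigD1 (Ordinal lth)) //= Enh !binn mul1r big1 ?addr0 // => j neq.
  have {}neq : (j != h :> nat).
    by apply: contra neq => /eqP E; apply/eqP/val_inj.
  have [jh|hj] := ltnP j h; last by rewrite bin_small ?mul0r //; lia.
  rewrite mulnC [X in (X * _)%N]bin_small ?mul0r //.
  by move: (nat_of_ord j) jh => k; rewrite /n; lia.
have <- : \sum_(d < h.*2.+2) W d * u ^+ d * v ^+ (n - d)
    = (v + x ^+ n * u) ^+ h * (v + x * u) ^+ h.+1.
  by rewrite -sum_binM_hom addnS addnn.
rewrite big_ord_recl big_ord_recr /= W0 /bump /= add1n Wn subn0 subnn.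
rewrite !expr0 !mulr1 mul1r.
rewrite (_ : forall r s t : F, r + (s + t) - r - t = s); last by move=> *; ring.
rewrite big_distrr /=; apply: eq_bigr => i _.
by rewrite (g_poly_horner _ h) // -/n -/(W i.+1) !mulrA.
Qed.

(** * Values of T and its two branches *)

Lemma subst3_T_horner (F : fieldType) q (a b c : {poly F}) (t : F) :
  let x := a.[t] in let y := b.[t] in let z := c.[t] in
  (subst3 (T_mpoly F q) a b c).[t] =
  x * y - 2%:R^-1 * ((x ^+ (q ^ 2 + 1)%N./2 - x) * (y ^+ q - y)) + z
  - \sum_(i < q.-1) (g_poly F q i).[x] * (y ^+ q - y) ^+ i.+1
                      * (z ^+ q - z) ^+ (q - i.+1).
Proof.
have subD f g : subst3 (f + g) a b c = subst3 f a b c + subst3 g a b c.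
  exact: rmorphD.
have subN f : subst3 (- f) a b c = - subst3 f a b c by exact: rmorphN.
have subM f g : subst3 (f * g) a b c = subst3 f a b c * subst3 g a b c.
  exact: rmorphM.
have subX f n : subst3 (f ^+ n) a b c = subst3 f a b c ^+ n.
  exact: rmorphXn.
have subZ k f : subst3 (k *: f) a b c = k%:P * subst3 f a b c by exact: mmapZ.
have subH f g : (subst3 (horner_alg f g) a b c).[t] = g.[(subst3 f a b c).[t]].
  elim/poly_ind: g => [|g k IHg].
    by rewrite rmorph0 [subst3 0 a b c]rmorph0 !horner0.
  rewrite rmorphD rmorphM /= horner_algX horner_algC subD subM subZ.
  by rewrite [subst3 1 a b c]rmorph1 !hornerE IHg.
have sub0 : subst3 'X_0 a b c = a by rewrite /subst3 mmapX mmap1U.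
have sub1 : subst3 'X_1 a b c = b by rewrite /subst3 mmapX mmap1U.
have sub2 : subst3 'X_2 a b c = c by rewrite /subst3 mmapX mmap1U.
rewrite /T_mpoly !(subD, subN, subM, subZ) !hornerE !subH sub0 sub1 sub2.
rewrite [subst3 (\sum_(i < _) _) _ _ _]raddf_sum horner_sum /=.
rewrite /t_poly !hornerE.
congr (_ - _); apply: eq_bigr => i _.
rewrite -[mmap _ _ _]/(subst3 _ a b c) !(subM, subX).
by rewrite !hornerM !horner_exp !subH sub0 sub1 sub2 !hornerE.
Qed.

(* In F_(q^2) with q = 2h + 1, [m ^+ (q.+1 * h)] is the quadratic character of m,
   so this is one of the two quadratic classes, which one depending on h. *)
Definition quad_class (F : fieldType) q h (m : F) : bool :=
  (- 1) ^+ h * m ^+ (q.+1 * h) == 1.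

Definition branch (F : fieldType) q h (A B : F) : F :=
  if quad_class F q h (B - A) then B else A.

Lemma quad_classN (F : fieldType) q h (m : F) :
  odd q -> quad_class F q h (- m) = quad_class F q h m.
Proof.
move=> oq; rewrite /quad_class !exprM (exprNn m).
by rewrite -(signr_odd _ q.+1) /= oq mul1r.
Qed.

Lemma branch_inj (F : fieldType) q h (A B A' B' : F) :
    odd q -> quad_class F q h (A' - A) = quad_class F q h (B' - B) ->
  branch F q h A B = branch F q h A' B' -> A = A' \/ B = B'.
Proof.
move=> oq eqN; rewrite /branch.
case N1: (quad_class F q h (B - A)); case N2: (quad_class F q h (B' - A'));
  [by right | | | by left] => E; move: N1 N2 eqN.
  by rewrite E => -> ->.
(* Here A = B', so the differences occur with opposite signs. *)
by rewrite -E -quad_classN // opprB -(quad_classN _ _ _ (A' - A)) // opprB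
  => -> ->.
Qed.

Lemma T_branch (F : finFieldType) h q (a b c : {poly F}) (t : F) :
    [pchar F].-nat q -> (2%:R : F) != 0 -> q = h.*2.+1 -> #|F| = (q ^ 2)%N ->
  let x := a.[t] in let y := b.[t] in let z := c.[t] in
  (subst3 (T_mpoly F q) a b c).[t]
  = branch F q h (x * y + z) (x * y ^+ q + z ^+ q).
Proof.
move=> qF two0 defq cardF x y z.
rewrite subst3_T_horner -/x -/y -/z (sum_g_poly _ h) //.
(* The q-th power is an involution on F_Q, so it negates u and v. *)
have frobK (w : F) : (w ^+ q - w) ^+ q = - (w ^+ q - w).
  by rewrite subrXn_pchar // -exprM mulnn -cardF expf_card opprB.
rewrite !frobK; set u := y ^+ q - y; set v := z ^+ q - z.
rewrite /branch; set m := _ - (x * y + z).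
have Em : v + x * u = m by rewrite /m /u /v; ring.
have -> : v + x ^+ q * u = - (m ^+ q).
  rewrite -Em exprDn_pchar // exprMn [v ^+ q]frobK [u ^+ q]frobK -/u -/v.
  by rewrite mulrN opprD !opprK.
pose chi := (-1) ^+ h * m ^+ (q.+1 * h).
have -> : (- m ^+ q) ^+ h * (v + x * u) ^+ h.+1 = chi * m.
  rewrite Em exprNn -exprM -mulrA -exprD /chi -mulrA -exprSr.
  by congr (_ * _ ^+ _); rewrite mulSn addnS addnC.
have -> : (x ^+ q) ^+ h * x ^+ h.+1 = x ^+ (q ^ 2 + 1)./2.
  by rewrite -exprM -exprD; congr (_ ^+ _); rewrite defq; nia.
(* The terms in x^((Q+1)/2) u cancel; chi = 1 will give B and chi = -1 will give A. *)
transitivity (x * y + z + 2%:R^-1 * (chi * m + m)).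
  by move: (x ^+ _) => r; rewrite -Em; field.
rewrite /quad_class -/chi.
have halfK : 2%:R^-1 * (m + m) = m by field.
have [->|chi1] := eqVneq chi 1.
  by rewrite mul1r halfK /m addrC subrK.
(* If m = 0 then A = B; otherwise chi^2 = m^(Q-1) = 1. *)
have [->|m0] := eqVneq m 0; first by rewrite mulr0 addr0 mulr0 addr0.
have chi2 : chi ^+ 2 = 1.
  rewrite exprMn sqrr_sign mul1r -exprM; apply: (mulfI m0).
  by rewrite -exprS mulr1 -[RHS]expf_card cardF;
    congr (_ ^+ _); rewrite defq; nia.
move/eqP: chi2; rewrite sqrf_eq1 (negPf chi1) => /eqP->.
by rewrite mulN1r addNr mulr0 addr0.
Qed.

(** * Injectivity in each variable *)

Theorem mainTheorem2 (p e q Q : nat) (F : finFieldType)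
    (p_prime : prime p) (p_odd : odd p) (e_gt0 : (0 < e)%N)
    (def_q : q = (p ^ e)%N) (def_Q : Q = (q ^ 2)%N) (cardF : #|F| = Q) :
  [/\ forall y z : F, y != 0 ->
        permutation_poly (subst3 (T_mpoly F q) 'X y%:P z%:P),
      forall x z : F, x != 0 ->
        permutation_poly (subst3 (T_mpoly F q) x%:P 'X z%:P)
    & forall x y : F,
        permutation_poly (subst3 (T_mpoly F q) x%:P y%:P 'X)].
Proof.
have pF : p \in [pchar F].
  by apply: (@card_finPcharP F p (e * 2)); rewrite // expnM -def_q -def_Q.
have qF : [pchar F].-nat q.
  by rewrite def_q pnatX (eq_pnat _ (pcharf_eq pF)) pnat_id.
have oq : odd q by rewrite def_q oddX p_odd orbT.
have two0 : (2%:R : F) != 0.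
  rewrite -(dvdn_pcharf pF) dvdn_prime2 //.
  by apply: contraTneq p_odd => ->.
rewrite def_Q in cardF.
have defq : q = (q./2).*2.+1 by rewrite -[LHS]odd_double_half oq.
have frobM (a b : F) :
  quad_class F q q./2 (a ^+ q * b) = quad_class F q q./2 (a * b).
  (* (a^q)^(q+1) = a^Q a^q = a^(q+1). *)
  suff E : (a ^+ q * b) ^+ q.+1 = (a * b) ^+ q.+1.
    by rewrite /quad_class !exprM E.
  by rewrite !exprMn -exprM mulnS mulnn exprD -cardF expf_card -exprSr.
have frob_inj : injective (fun w : F => w ^+ q).
  move=> w1 w2 /= /(congr1 (fun w => w ^+ q)).
  by rewrite -!exprM mulnn -cardF !expf_card.
have subr2 (r s t : F) : r + t - (s + t) = r - s by ring.
(* With d = t - s, the differences A' - A and B' - B are d y and d y^q, then x d and x d^q, then d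
   and d^q; under the assumptions of each case, either one vanishes only for d = 0. *)
split=> [y z y0|x z x0|x y]; apply: injF_bij => s t;
  rewrite !(T_branch _ q./2) // !hornerE.
- have E : quad_class F q q./2 (t * y + z - (s * y + z))
      = quad_class F q q./2 (t * y ^+ q + z ^+ q - (s * y ^+ q + z ^+ q)).
    by rewrite !subr2 -!mulrBl !(mulrC (t - s)) frobM.
  case/(branch_inj _ _ _ _ _ _ _ oq E) => /addIr; apply: mulIf => //.
  exact: expf_neq0.
- have E : quad_class F q q./2 (x * t + z - (x * s + z))
      = quad_class F q q./2 (x * t ^+ q + z ^+ q - (x * s ^+ q + z ^+ q)).
    by rewrite !subr2 -!mulrBr -subrXn_pchar // ![x * _]mulrC frobM.
  by case/(branch_inj _ _ _ _ _ _ _ oq E) => /addIr/(mulfI x0) // /frob_inj.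
- have E : quad_class F q q./2 (x * y + t - (x * y + s))
      = quad_class F q q./2 (x * y ^+ q + t ^+ q - (x * y ^+ q + s ^+ q)).
    by rewrite !(addrC (x * _)) !subr2 -subrXn_pchar //
      -[(t - s) ^+ q]mulr1 frobM mulr1.
  by case/(branch_inj _ _ _ _ _ _ _ oq E) => /addrI // /frob_inj.
Qed.
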